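(* Let $K$ be an algebraic number field with ring of integers $\mathcal{O}_K$, let $m\geq 1$, and let $\mathfrak{B}$ be an infinite collection of proper ideals of finite index in the ring $\mathcal{O}_K^m$. Put $\mathcal{M}_\mathfrak{B}=\bigcup_{\mathfrak{b}\in\mathfrak{B}}\mathfrak{b}$, $\mathcal{F}_\mathfrak{B}=\mathcal{O}_K^m\setminus\mathcal{M}_\mathfrak{B}$, $\eta=\mathbb{1}_{\mathcal{F}_\mathfrak{B}}\in\{0,1\}^{\mathcal{O}_K^m}$, and let $X_\eta$ be the orbit closure of $\eta$. The following conditions are equivalent: (a) the system $(X_\eta,(S_a)_{a\in\mathcal{O}_K^m})$ is proximal; (b) $\mathbf{0}\in X_\eta$, where $\mathbf{0}_a=0$ for all $a\in\mathcal{O}_K^m$; (c) for any $k\geq 1$ and any proper ideals $I_1,\dots,I_k$ of finite index in $\mathcal{O}_K^m$, we have $\mathcal{M}_\mathfrak{B}\not\subseteq\bigcup_{j=1}^k I_j$; (d) $\mathfrak{B}$ contains an infinite collection of pairwise coprime ideals; (e) for any $a\in\mathcal{O}_K^m$ and any ideal $I$ of finite index in $\mathcal{O}_K^m$, we have $I+a\not\subseteq\mathcal{F}_\mathfrak{B}$; (f) $d^*(\mathcal{M}_\mathfrak{B})=1$.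
   Context: $\mathcal{O}_K^m$ is the product ring with coordinatewise addition and multiplication; it is viewed as a countable abelian group under addition. For a countable abelian group $\mathbb{G}$, the shift action on $\{0,1\}^{\mathbb{G}}$ (product topology, compact metrizable) is $(S_h x)_g=x_{g+h}$. The orbit closure $X_\eta$ of $\eta$ is the closure of $\{S_g\eta: g\in\mathbb{G}\}$. Fixing a compatible metric $D$, a pair $(x,y)$ is proximal if $\liminf_{g\to\infty}D(S_gx,S_gy)=0$ (where $g\to\infty$ means leaving every finite subset of $\mathbb{G}$), and the system is proximal if every pair of points of $X_\eta$ is proximal. Two proper ideals (or subgroups) $I,J$ are coprime if $I+J$ is the whole ring (group). A Følner sequence in $\mathbb{G}$ is a sequence of finite sets $F_n$ with $|(F_n+g)\cap F_n|/|F_n|\to 1$ for each $g\in\mathbb{G}$. The upper Banach density of $A\subseteq\mathbb{G}$ is $d^*(A)=\sup\{\limsup_{n\to\infty}|A\cap F_n|/|F_n| : (F_n) \text{ a Følner sequence in } \mathbb{G}\}$. *)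

(* Defs.v *)
From HB Require Import structures.
From mathcomp Require Import all_boot all_order all_algebra all_field.
From Stdlib Require Import ClassicalEpsilon.
Set Implicit Arguments. Unset Strict Implicit. Unset Printing Implicit Defensive.
Import Order.TTheory GRing.Theory Num.Theory.
Local Open Scope ring_scope.

Definition pb (P : Prop) : bool :=
  if excluded_middle_informative P then true else false.

Section NF.
Variables (K : fieldExtType rat) (m : nat).

Notation V := 'rV[K]_m.

Definition alg_int (x : K) : Prop :=
  exists p : {poly int}, p \is monic /\ root (map_poly (fun z : int => z%:~R) p) x.

Definition inOKm (v : V) : Prop := forall i : 'I_m, alg_int (v 0 i).

Definition vmul (a b : V) : V := \row_i (a 0 i * b 0 i).

Definition ideal (I : V -> Prop) : Prop :=
  [/\ forall x, I x -> inOKm x,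
      I 0,
      forall x y, I x -> I y -> I (x - y)
    & forall a x, inOKm a -> I x -> I (vmul a x)].

Definition proper (I : V -> Prop) : Prop := exists g, inOKm g /\ ~ I g.

Definition finite_index (I : V -> Prop) : Prop :=
  exists s : seq V, (forall r, r \in s -> inOKm r) /\
    forall g, inOKm g -> exists2 r, r \in s & I (g - r).

Definition pfi_ideal (I : V -> Prop) : Prop := [/\ ideal I, proper I & finite_index I].

Definition same_set (I J : V -> Prop) : Prop := forall x, I x <-> J x.

Definition infinite_family (C : (V -> Prop) -> Prop) : Prop :=
  forall s : list (V -> Prop), exists b, C b /\ forall c, List.In c s -> ~ same_set b c.

Definition coprime_ideals (I J : V -> Prop) : Prop :=
  forall g, inOKm g -> exists i j, I i /\ J j /\ g = i + j.

Definition MB (B : (V -> Prop) -> Prop) (x : V) : Prop := exists b, B b /\ b x.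
Definition FB (B : (V -> Prop) -> Prop) (x : V) : Prop := inOKm x /\ ~ MB B x.

(* eta = indicator of F_B (only its values on O_K^m matter) *)
Definition etaB (B : (V -> Prop) -> Prop) (g : V) : bool := pb (FB B g).

(* points of {0,1}^(O_K^m) are represented by functions V -> bool; only the
   values on O_K^m are relevant. (S_h x)_g = x (g + h). *)
Definition finite_subset (F : seq V) : Prop := forall f, f \in F -> inOKm f.

(* x lies in the orbit closure of y (product topology: every cylinder
   neighbourhood of x meets the orbit of y) *)
Definition in_orbit_closure (y x : V -> bool) : Prop :=
  forall F : seq V, finite_subset F ->
    exists h, inOKm h /\ forall f, f \in F -> y (f + h) = x f.

(* (x, y) proximal: liminf_{g -> oo} D(S_g x, S_g y) = 0, i.e. for every
   cylinder window F and every finite set E there is g outside E with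
   S_g x and S_g y agreeing on F. *)
Definition proximal_pair (x y : V -> bool) : Prop :=
  forall F E : seq V, finite_subset F -> finite_subset E ->
    exists g, [/\ inOKm g, g \notin E & forall f, f \in F -> x (f + g) = y (f + g)].

Definition proximal_system (eta0 : V -> bool) : Prop :=
  forall x y, in_orbit_closure eta0 x -> in_orbit_closure eta0 y -> proximal_pair x y.

Definition ratio (P : V -> bool) (F : seq V) : rat := (count P F)%:R / (size F)%:R.

Definition folner (F : nat -> seq V) : Prop :=
  [/\ forall n, uniq (F n) /\ finite_subset (F n) /\ F n <> [::]
    & forall g, inOKm g -> forall e : rat, 0 < e -> exists N, forall n, (N <= n)%N ->
        `|1 - ratio (fun x => (x - g) \in F n) (F n)| < e ].
(* (F n + g) ∩ F n = { x in F n | x - g in F n } *)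

Definition limsup_le (u : nat -> rat) (c : rat) : Prop :=
  forall e : rat, 0 < e -> exists N, forall n, (N <= n)%N -> u n < c + e.
Definition limsup_ge (u : nat -> rat) (c : rat) : Prop :=
  forall e : rat, 0 < e -> forall N, exists n, (N <= n)%N /\ c - e < u n.

(* d*(A) = 1, where d*(A) = sup over Følner sequences of limsup |A ∩ F_n|/|F_n| *)
Definition upper_banach_density_one (A : V -> Prop) : Prop :=
  (forall F, folner F -> limsup_le (fun n => ratio (fun x => pb (A x)) (F n)) 1) /\
  (forall e : rat, 0 < e -> exists F, folner F /\
      limsup_ge (fun n => ratio (fun x => pb (A x)) (F n)) (1 - e)).

End NF.

(* Main.v *)
(** Write R for O_K^m and M for the union of the ideals of B.  Everything reduces to the
    existence of a sequence u of pairwise coprime members of B.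
    If the system is proximal and the coset I + a misses M, apply proximality to eta and
    its shift by a, with representatives of R modulo I cap b (b in B) as window: at some
    point of I cap b the first vanishes while the second is 1.  If M were covered by proper
    I_1, ..., I_k, then 1 + (I_1 cap ... cap I_k) would miss M.  If no b in B is coprime to
    all of c_1, ..., c_n in B, then M is covered by the proper ideals containing some c_i,
    which are finitely many.  Given u, the Chinese remainder theorem, combined with
    representatives modulo a finite intersection of the u_i, makes any two points of the
    orbit closure vanish simultaneously on a translate of any window; in particular M
    contains translates of all finite sets.  Translating a Folner sequence into M gives
    density one, while a coset of finite index has positive lower density along every
    Folner sequence. *)

Require Import Defs.
From HB Require Import structures.
From mathcomp Require Import all_boot all_order all_algebra all_field.
From mathcomp Require Import zify ring lra.
From Stdlib Require Import ClassicalEpsilon.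
Import Order.TTheory GRing.Theory Num.Theory.
Set Implicit Arguments.
Unset Strict Implicit.
Unset Printing Implicit Defensive.
Local Open Scope ring_scope.

(** * Almost invariant finite sets *)

Lemma bernoulli (e : rat) n : 0 < e -> 1 + n%:R * e <= (1 + e) ^+ n.
Proof.
move=> e0; elim: n => [|n IH]; first by rewrite expr0 mul0r addr0.
rewrite exprS -[n.+1]addn1 natrD.
have : (1 + e) * (1 + n%:R * e) <= (1 + e) * (1 + e) ^+ n by rewrite ler_pM2l //; lra.
have : 0 <= n%:R * e * e by rewrite !mulr_ge0 // ltW.
lra.
Qed.

(** For [n = q (k + 1)], Bernoulli gives [(1 + e)^n >= (q e)^(k + 1)], while
    [(n + 1)^k <= (q (k + 2))^k]; the former wins once [q > (k + 2)^k / e^(k + 1)]. *)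
Lemma exp_beats_poly (e : rat) k : 0 < e ->
  exists n, (n.+1%:R : rat) ^+ k < (1 + e) ^+ n.
Proof.
move=> e0.
pose a : rat := (k.+2%:R) ^+ k / e ^+ k.+1.
have a0 : 0 <= a by rewrite divr_ge0 // exprn_ge0 // ltW.
have [q [aq q_gt0]] : exists q : nat, a < q%:R /\ (0 < q)%N.
  exists (Num.Def.archi_bound a).+1; split=> //.
  by apply: lt_trans (archi_boundP a0) _; rewrite ltr_nat.
have q0 : (0 : rat) < q%:R by rewrite ltr0n.
exists (q * k.+1)%N.
have le1 : ((q * k.+1).+1%:R : rat) ^+ k <= (q%:R * k.+2%:R) ^+ k.
  apply: lerXn2r; rewrite ?nnegrE ?mulr_ge0 // -natrM ler_nat.
  by lia.
apply: le_lt_trans le1 _; rewrite exprM.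
apply: (@lt_le_trans _ _ ((q%:R * e) ^+ k.+1)); last first.
  have e1 : 0 <= 1 + e by rewrite addr_ge0 // ltW.
  apply: lerXn2r; rewrite ?nnegrE ?mulr_ge0 ?exprn_ge0 ?(ltW e0) //.
  by apply: le_trans (bernoulli q e0); rewrite lerDr.
rewrite [ltRHS]exprMn [ltLHS]exprMn [q%:R ^+ k.+1]exprS -[ltRHS]mulrA [ltRHS]mulrCA.
rewrite ltr_pM2l ?exprn_gt0 //.
by rewrite -ltr_pdivrMr ?exprn_gt0.
Qed.

Section Boxes.
Variable G : zmodType.

(** Combinations of [s] with coefficients in [[0, L)]; [undup] is there because relations in [G] can
    make them coincide. *)
Fixpoint box (L : nat) (s : seq G) : seq G :=
  if s is g :: s' then undup [seq g *+ i + x | i <- iota 0 L, x <- box L s'] else [:: 0].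

Lemma box_uniq L s : uniq (box L s).
Proof. by case: s => //= g s; apply: undup_uniq. Qed.

Lemma size_box L s : (size (box L s) <= L ^ size s)%N.
Proof.
elim: s => //= g s IH; apply: leq_trans (size_undup _) _.
by rewrite size_allpairs size_iota expnS leq_mul2l IH orbT.
Qed.

Lemma box_consP L g s x :
  reflect (exists i y, [/\ (i < L)%N, y \in box L s & x = g *+ i + y])
          (x \in box L (g :: s)).
Proof.
rewrite /= mem_undup; apply: (iffP allpairsP) => [[[i y] /= [hi hy ->]]|[i [y [hi hy ->]]]].
  by exists i, y; split=> //; move: hi; rewrite mem_iota.
by exists (i, y); split=> //=; rewrite mem_iota.
Qed.

Lemma box_mono L s : {subset box L s <= box L.+1 s}.
Proof.
elim: s => // g s IH x /box_consP [i [y [hi hy ->]]].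
by apply/box_consP; exists i, y; split; [exact: ltnW | exact: IH | ].
Qed.

Lemma box_shift L s g x : g \in s -> x \in box L s -> x + g \in box L.+1 s.
Proof.
elim: s x => // g' s IH x; rewrite inE => /orP [/eqP ->|gs] /box_consP [i [y [hi hy ->]]].
  apply/box_consP; exists i.+1, y; split; [by []|exact: box_mono|].
  by rewrite mulrSr addrAC.
apply/box_consP; exists i, (y + g); split; [exact: ltnW|exact: IH|by rewrite addrA].
Qed.

Lemma box0 L s : 0 \in box L.+1 s.
Proof.
elim: s => [|g s IH]; first by rewrite inE.
by apply/box_consP; exists 0%N, 0; rewrite mulr0n addr0.
Qed.

Lemma box_closed (P : G -> Prop) L s : P 0 -> (forall x y, P x -> P y -> P (x + y)) ->
  (forall g, g \in s -> P g) -> forall x, x \in box L s -> P x.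
Proof.
move=> P0 PD; elim: s => [|g s IH] Ps x; first by rewrite inE => /eqP ->.
move=> /box_consP [i [y [_ hy ->]]]; apply: (PD).
  elim: i => [|i IHi]; first by rewrite mulr0n.
  by rewrite mulrS; apply: (PD) IHi; apply: Ps; rewrite inE eqxx.
by apply: IH hy => h hs; apply: Ps; rewrite inE hs orbT.
Qed.

(** [S] and the points of [S + g] outside [S] are disjoint parts of [T]; the points of [S + g]
    inside [S] are those counted on the right. *)
Lemma count_shift (S T : seq G) (g : G) : uniq S -> {subset S <= T} ->
  (forall x, x \in S -> x + g \in T) ->
  (2 * size S <= size T + count (fun x : G => (x - g)%R \in S) S)%N.
Proof.
move=> uS sST sgT.
pose N := [seq x + g | x <- S & x + g \notin S].
have uN : uniq (S ++ N).
  rewrite cat_uniq uS map_inj_uniq ?filter_uniq //; last exact: addIr.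
  rewrite andbT; apply/hasPn => y /mapP [x]; rewrite mem_filter => /andP [h _ ->].
  exact: h.
have hT : (size S + size N <= size T)%N.
  rewrite -size_cat; apply: uniq_leq_size uN _ => y; rewrite mem_cat => /orP [/sST //|].
  by move=> /mapP [x]; rewrite mem_filter => /andP [_ h] ->; apply: sgT.
have hN : size N = count (fun x => x + g \notin S) S by rewrite size_map size_filter.
have hC : (count (fun x : G => (x + g)%R \in S) S <= count (fun x : G => (x - g)%R \in S) S)%N.
  rewrite -!size_filter -(size_map (+%R^~ g)); apply: uniq_leq_size.
    by rewrite map_inj_uniq ?filter_uniq //; apply: addIr.
  move=> y /mapP [x]; rewrite mem_filter => /andP [h1 h2] ->.
  by rewrite mem_filter h1 addrK h2.
have hP : (count (fun x : G => (x + g)%R \in S) S + size N = size S)%N.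
  by rewrite hN; exact: count_predC.
by rewrite mul2n -addnn -{2}hP [(count _ _ + _)%N]addnC addnA leq_add.
Qed.

(* The boxes over [s] grow polynomially in [L], so some step [L -> L.+1] enlarges
   the box by a factor less than [1 + e]. *)
Lemma almost_invariant (s : seq G) (e : rat) : 0 < e ->
  exists L, let S := box L.+1 s in forall g, g \in s ->
    `|1 - (count (fun x => x - g \in S) S)%:R / (size S)%:R| < e.
Proof.
move=> e0; have [L hL] : exists L, (size (box L.+2 s))%:R < (1 + e) * (size (box L.+1 s))%:R.
  apply: NNPP => no.
  have big L : (1 + e) ^+ L <= (size (box L.+1 s))%:R :> rat.
    elim: L => [|L IH].
      by rewrite expr0 -[1]/(1%:R) ler_nat lt0n; have := box0 0 s; case: (box _ _).
    have /negP : ~ (size (box L.+2 s))%:R < (1 + e) * (size (box L.+1 s))%:R :> rat.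
      by move=> h; apply: no; exists L.
    rewrite -leNgt exprS; apply: le_trans; rewrite ler_pM2l //; lra.
  have [n hn] := exp_beats_poly (size s) e0.
  have := le_lt_trans (big n) (le_lt_trans _ hn); rewrite -natrX ler_nat size_box.
  by rewrite ltxx => /(_ isT).
exists L => S g gs.
have := @count_shift S (box L.+2 s) g (box_uniq _ _) (@box_mono _ _)
  (fun x xS => box_shift gs xS).
have S0 : (0 : rat) < (size S)%:R.
  by rewrite ltr0n lt0n; have := box0 L s; rewrite -/S; case: (S).
have := count_size (fun x => x - g \in S) S.
rewrite -/S in hL; move: (count _ _) => c; rewrite -!(ler_nat rat) natrD natrM => h1 h2.
rewrite ger0_norm ?subr_ge0 ?ler_pdivrMr ?mul1r // ltrBlDr -ltrBlDl.
rewrite ltr_pdivlMr //; lra.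
Qed.

End Boxes.

(** * Ideals of finite index *)

Section Family.
Variables (K : fieldExtType rat) (m : nat).
Local Notation V := 'rV[K]_m.
Local Notation iset := (V -> Prop).
Implicit Types (x y z g h : V) (I J : iset).

Lemma pbP (P : Prop) : reflect P (pb P).
Proof. by rewrite /pb; case: excluded_middle_informative => h; constructor. Qed.

Lemma alg_intP (x : K) : alg_int x <-> integralOver (intr : int -> K) x.
Proof. by split=> [[p [mp rp]]|[p mp rp]]; exists p. Qed.

Lemma inOK0 : inOKm (0 : V).
Proof. by move=> i; apply/alg_intP; rewrite mxE; apply: integral0. Qed.

Lemma inOKB x y : inOKm x -> inOKm y -> inOKm (x - y).
Proof.
move=> hx hy i; apply/alg_intP; rewrite !mxE.
by apply: integral_sub; apply/alg_intP; [apply: hx|apply: hy].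
Qed.

Lemma inOKN x : inOKm x -> inOKm (- x).
Proof. by move=> hx; rewrite -sub0r; apply: inOKB => //; apply: inOK0. Qed.

Lemma inOKD x y : inOKm x -> inOKm y -> inOKm (x + y).
Proof. by move=> hx hy; rewrite -[y]opprK; apply: inOKB => //; apply: inOKN. Qed.

Lemma inOKM x y : inOKm x -> inOKm y -> inOKm (vmul x y).
Proof.
move=> hx hy i; apply/alg_intP; rewrite !mxE.
by apply: integral_mul; apply/alg_intP; [apply: hx|apply: hy].
Qed.

Definition vone : V := const_mx 1.

Lemma inOK1 : inOKm vone.
Proof. by move=> i; apply/alg_intP; rewrite mxE; apply: integral1. Qed.

Lemma vmulC x y : vmul x y = vmul y x.
Proof. by apply/rowP => i; rewrite !mxE mulrC. Qed.

Lemma vmul1 x : vmul x vone = x.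
Proof. by apply/rowP => i; rewrite !mxE mulr1. Qed.

Lemma vmulBr x y z : vmul x (y - z) = vmul x y - vmul x z.
Proof. by apply/rowP => i; rewrite !mxE mulrBr. Qed.

Lemma idealN I x : ideal I -> I x -> I (- x).
Proof. by case=> _ I0 IB _ Ix; rewrite -sub0r; apply: IB. Qed.

Lemma idealD I x y : ideal I -> I x -> I y -> I (x + y).
Proof.
move=> hI Ix Iy; rewrite -[y]opprK; case: (hI) => _ _ IB _.
by apply: IB => //; apply: idealN.
Qed.

Lemma idealB I x y : ideal I -> I x -> I y -> I (x - y).
Proof. by case=> _ _ IB _; apply: IB. Qed.

Lemma idealBC I x y : ideal I -> I (x - y) -> I (y - x).
Proof. by move=> hI /(idealN hI); rewrite opprB. Qed.

Lemma ideal_trans I y x z : ideal I -> I (x - y) -> I (y - z) -> I (x - z).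
Proof. by move=> hI h1 h2; have := idealD hI h1 h2; rewrite addrA subrK. Qed.

Lemma proper1 I : ideal I -> Defs.proper I -> ~ I vone.
Proof.
by case=> _ _ _ IM [g [hg nIg]] I1; apply: nIg; rewrite -[g]vmul1; apply: IM.
Qed.

Lemma ideal_full : ideal (@inOKm K m).
Proof. by split=> //; [exact: inOK0|exact: inOKB|exact: inOKM]. Qed.

Lemma fi_full : finite_index (@inOKm K m).
Proof.
exists [:: 0]; split=> [r|g hg]; first by rewrite inE => /eqP ->; apply: inOK0.
by exists 0; rewrite ?inE ?subr0.
Qed.

Lemma ideal_cap I J : ideal I -> ideal J -> ideal (fun x => I x /\ J x).
Proof.
move=> [I1 I2 I3 I4] [J1 J2 J3 J4]; split=> // [x [/I1]|x y [? ?] [? ?]|a x ha [? ?]] //.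
  by split; [apply: I3|apply: J3].
by split; [apply: I4|apply: J4].
Qed.

(** Each pair of representatives gets a common point of its two cosets if there is one, and the
    default [0] otherwise. *)
Lemma fi_cap I J : ideal I -> ideal J -> finite_index I -> finite_index J ->
  finite_index (fun x => I x /\ J x).
Proof.
move=> hI hJ [s [_ hs]] [t [_ ht]].
have pick (p : V * V) : exists x, inOKm x /\
   ((exists y, [/\ inOKm y, I (y - p.1) & J (y - p.2)]) -> I (x - p.1) /\ J (x - p.2)).
  case: (excluded_middle_informative
    (exists y, [/\ inOKm y, I (y - p.1) & J (y - p.2)])) => [[y [hy h1 h2]]|no].
    by exists y.
  by exists 0; split=> [|//]; apply: inOK0.
pose f p := proj1_sig (constructive_indefinite_description _ (pick p)).
have fP p : inOKm (f p) /\ ((exists y, [/\ inOKm y, I (y - p.1) & J (y - p.2)]) ->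
    I (f p - p.1) /\ J (f p - p.2)).
  by rewrite /f; case: constructive_indefinite_description.
exists [seq f (a, b) | a <- s, b <- t]; split=> [r /allpairsP [p [_ _ ->]]|g hg].
  by case: (fP (p.1, p.2)).
have [a ha Ia] := hs g hg; have [b hb Jb] := ht g hg.
exists (f (a, b)); first by apply/allpairsP; exists (a, b).
have [_ /= [|h1 h2]] := fP (a, b); first by exists g.
by split; [exact: ideal_trans hI Ia (idealBC hI h1)|exact: ideal_trans hJ Jb (idealBC hJ h2)].
Qed.

Lemma ideal_caps (s : list iset) :
  (forall I, List.In I s -> ideal I /\ finite_index I) ->
  exists J, [/\ ideal J, finite_index J & forall I, List.In I s -> forall x, J x -> I x].
Proof.
elim: s => [_|I s IH hs].
  by exists (@inOKm K m); split=> //; [apply: ideal_full|apply: fi_full].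
have [|J [iJ fJ hJ]] := IH; first by move=> I' hI'; apply: hs; right.
have [iI fI] := hs I (or_introl erefl).
exists (fun x => I x /\ J x); split; [exact: ideal_cap|exact: fi_cap|].
by move=> I' [<- x []//|/hJ h x [_ /h]].
Qed.

(** A finite set has finitely many subsets: split [P] by membership of one point of [r] at a time
    and keep one member for each trace that occurs. *)
Lemma ideals_by_trace (P : iset -> Prop) (r : seq V) :
  exists L : list iset, (forall I, List.In I L -> P I) /\
    forall J, P J -> exists2 I, List.In I L & forall x, x \in r -> (I x <-> J x).
Proof.
elim: r P => [|x r IH] P.
  case: (excluded_middle_informative (exists J, P J)) => [[J PJ]|no].
    by exists [:: J]; split=> [I [<-|[]]//|J' _]; exists J => //; left.
  by exists [::]; split=> // J PJ; case: no; exists J.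
have [L1 [h1 k1]] := IH (fun J => P J /\ J x).
have [L2 [h2 k2]] := IH (fun J => P J /\ ~ J x).
exists (List.app L1 L2); split=> [I /(@List.in_app_or _ _ _ _) [/h1 []|/h2 []]//|J PJ].
case: (excluded_middle_informative (J x)) => Jx.
  have [I IL hI] := k1 J (conj PJ Jx); have [_ Ix] := h1 I IL.
  exists I => [|y]; first by apply: List.in_or_app; left.
  by rewrite inE => /orP [/eqP -> //|]; apply: hI.
have [I IL hI] := k2 J (conj PJ Jx); have [_ Ix] := h2 I IL.
exists I => [|y]; first by apply: List.in_or_app; right.
by rewrite inE => /orP [/eqP -> //|]; apply: hI.
Qed.

(* An ideal above [c] is determined by which coset representatives of [c] it contains. *)
Lemma ideals_above c : ideal c -> finite_index c ->
  exists L : list iset, (forall I, List.In I L -> pfi_ideal I) /\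
    forall J, pfi_ideal J -> (forall x, c x -> J x) ->
      exists2 I, List.In I L & forall x, J x -> I x.
Proof.
move=> ic [r [_ hr]].
have [L [h1 h2]] := ideals_by_trace (fun J => pfi_ideal J /\ forall x, c x -> J x) r.
exists L; split=> [I /h1 []//|J pJ cJ].
have [I IL hI] := h2 J (conj pJ cJ); exists I => // x Jx.
have [[iI _ _] cI] := h1 I IL; case: pJ => iJ _ _.
have [y yr cy] : exists2 y, y \in r & c (x - y) by apply: hr; case: iJ => hJ _ _ _; apply: hJ.
have Iy : I y.
  by apply/hI => //; have := idealB iJ Jx (cJ _ cy); rewrite opprB addrC subrK.
by have := idealD iI (cI _ cy) Iy; rewrite subrK.
Qed.

Lemma ideals_above_list (s : list iset) :
  (forall c, List.In c s -> ideal c /\ finite_index c) ->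
  exists L : list iset, (forall I, List.In I L -> pfi_ideal I) /\
    forall c J, List.In c s -> pfi_ideal J -> (forall x, c x -> J x) ->
      exists2 I, List.In I L & forall x, J x -> I x.
Proof.
elim: s => [_|c s IH hs]; first by exists [::]; split.
have [|L [h1 h2]] := IH; first by move=> c' hc'; apply: hs; right.
have [ic fc] := hs c (or_introl erefl).
have [L' [k1 k2]] := ideals_above ic fc.
exists (List.app L L'); split=> [I /(@List.in_app_or _ _ _ _) [/h1|/k1]//|c' J [<-|hc] pJ cJ].
  by have [I IL hI] := k2 J pJ cJ; exists I => //; apply: List.in_or_app; right.
by have [I IL hI] := h2 c' J hc pJ cJ; exists I => //; apply: List.in_or_app; left.
Qed.

Definition ideal_sum I J : iset := fun x => exists i j, I i /\ J j /\ x = i + j.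

(** Properness of the sum is the failure of coprimality; representatives modulo [I] also serve
    modulo the larger sum. *)
Lemma ideal_sum_pfi I J : ideal I -> ideal J -> finite_index I -> ~ coprime_ideals I J ->
  pfi_ideal (ideal_sum I J).
Proof.
move=> iI iJ fI nc; case: (iI) => I1 I2 I3 I4; case: (iJ) => J1 J2 J3 J4; split.
- split=> [x [i [j [/I1 hi [/J1 hj ->]]]]||x y [i [j [hi [hj ->]]]] [i' [j' [hi' [hj' ->]]]]
          |a x ha [i [j [hi [hj ->]]]]].
  + exact: inOKD.
  + by exists 0, 0; rewrite addr0.
  + exists (i - i'), (j - j'); split; first exact: I3.
    by split; [exact: J3|rewrite opprD addrACA].
  + exists (vmul a i), (vmul a j); split; first exact: I4.
    split; first exact: J4.
    by apply/rowP => k; rewrite !mxE mulrDr.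
- apply: NNPP => np; apply: nc => g hg; apply: NNPP => ns.
  by apply: np; exists g.
- case: fI => r [h1 h2]; exists r; split=> // g /h2 [x xr Ix]; exists x => //.
  by exists (g - x), 0; rewrite addr0.
Qed.

Lemma coprime_sym I J : coprime_ideals I J -> coprime_ideals J I.
Proof. by move=> h g /h [i [j [hi [hj ->]]]]; exists j, i; rewrite addrC. Qed.

Lemma coprime_not_same I J : ideal I -> Defs.proper I -> coprime_ideals I J -> ~ same_set I J.
Proof.
move=> iI [g [hg nIg]] cIJ sIJ; apply: nIg.
by have [i [j [hi [/sIJ hj ->]]]] := cIJ g hg; apply: idealD.
Qed.

(** * The Chinese remainder theorem for pairwise coprime ideals *)

Section Crt.
Variable u : nat -> iset.
Hypothesis iu : forall i, ideal (u i).
Hypothesis cu : forall i j, i <> j -> coprime_ideals (u i) (u j).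

(** Multiply, one for each index below [k], elements of those ideals that are 1 modulo [u n];
    coprimality provides them as summands of 1. *)
Lemma crt_idempotent n k : (k <= n)%N ->
  exists e, [/\ inOKm e, u n (vone - e) & forall i, (i < k)%N -> u i e].
Proof.
elim: k => [_|k IH kn].
  by exists vone; split; [exact: inOK1|rewrite subrr; case: (iu n)|].
have [e [he ne ke]] := IH (ltnW kn).
have [|i [j [hi [hj ij]]]] := @cu k n _ vone inOK1; first by move=> E; rewrite E ltnn in kn.
have [k1 k2 k3 k4] := iu k; have [n1 n2 n3 n4] := iu n.
exists (vmul e i); split; first exact: inOKM (k1 _ hi).
  have -> : vone - vmul e i = vmul i (vone - e) + (vone - i).
    by rewrite vmulBr vmul1 vmulC [_ + (_ - _)]addrC addrA subrK.
  by apply: idealD => //; [apply: n4 => //; apply: k1|rewrite ij addrC addKr].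
move=> l; rewrite ltnS leq_eqVlt => /orP [/eqP ->|lk]; first exact: k4.
by have [_ _ _ l4] := iu l; rewrite vmulC; apply: l4; [apply: k1|apply: ke].
Qed.

(** Adding [(t n - h) e], with [e] zero modulo the earlier ideals and one modulo [u n], corrects [h]
    at [n] and keeps the earlier congruences. *)
Lemma crt (t : nat -> V) n : (forall i, inOKm (t i)) ->
  exists h, inOKm h /\ forall i, (i < n)%N -> u i (h - t i).
Proof.
move=> ht; elim: n => [|n [h [hh ih]]]; first by exists 0; split; [exact: inOK0|].
have [e [he ne ke]] := crt_idempotent (leqnn n).
have hn : inOKm (t n - h) by apply: inOKB.
exists (h + vmul (t n - h) e); split; first by apply: inOKD => //; apply: inOKM.
move=> i; rewrite ltnS leq_eqVlt => /orP [/eqP ->|lin].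
  have -> : h + vmul (t n - h) e - t n = vmul (h - t n) (vone - e).
    by apply/rowP => k; rewrite !mxE; ring.
  by have [_ _ _ n4] := iu n; apply: n4 => //; apply: inOKB.
rewrite addrAC; apply: idealD => //; first exact: ih.
by have [_ _ _ n4] := iu i; apply: n4 => //; apply: ke.
Qed.

End Crt.

(** * Coprime sequences and proximality *)

(** Dependent choice, carrying the list of all earlier choices. *)
Lemma greedy_sequence (T : Type) (P : T -> Prop) (r : T -> T -> Prop) :
  (forall s : list T, (forall c, List.In c s -> P c) ->
     exists x : T, P x /\ forall c, List.In c s -> r x c) ->
  exists u : nat -> T, (forall i, P (u i)) /\ forall i j, (j < i)%N -> r (u i) (u j).
Proof.
move=> step.
(* The assumption on [s] moves under the existential so that choice yields a function on all lists;
   where it fails, the empty list supplies a default value. *)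
have step' (s : list T) : exists x : T, (forall c, List.In c s -> P c) ->
    P x /\ forall c, List.In c s -> r x c.
  case: (excluded_middle_informative (forall c, List.In c s -> P c)) => [hs|no].
    by have [x hx] := step s hs; exists x.
  by have [x _] := step nil (fun c hc => False_ind _ hc); exists x.
pose f s := proj1_sig (constructive_indefinite_description _ (step' s)).
have fP s : (forall c, List.In c s -> P c) -> P (f s) /\ forall c, List.In c s -> r (f s) c.
  by rewrite /f; case: constructive_indefinite_description.
pose l := fix l n := if n is n'.+1 then f (l n') :: l n' else nil.
have lP n c : List.In c (l n) -> P c.
  by elim: n c => //= n IH c [<-|/IH//]; case: (fP (l n)).
have lu i j : (j < i)%N -> List.In (f (l j)) (l i).
  elim: i => // i IH; rewrite ltnS leq_eqVlt => /orP [/eqP ->|/IH h]; first by left.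
  by right.
exists (fun n => f (l n)); split=> [i|i j ji]; have [h1 h2] := fP _ (lP i) => //.
by apply: h2; apply: lu.
Qed.

Section Conditions.
Variable B : iset -> Prop.
Hypothesis Binf : infinite_family B.
Hypothesis Bpfi : forall b, B b -> pfi_ideal b.

Definition coprime_sequence (u : nat -> iset) : Prop :=
  (forall i, B (u i)) /\ forall i j, i <> j -> coprime_ideals (u i) (u j).

Lemma etaB_MB x : MB B x -> etaB B x = false.
Proof. by move=> h; apply/negP => /pbP [_]. Qed.

Lemma etaB_false x : inOKm x -> etaB B x = false -> MB B x.
Proof. by move=> hx /pbP h; apply: NNPP => h'; apply: h. Qed.

Lemma orbit_closure_shift h : inOKm h -> in_orbit_closure (etaB B) (fun x => etaB B (x + h)).
Proof. by move=> hh F hF; exists h. Qed.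

Lemma proximal_meets_cosets : proximal_system (etaB B) ->
  forall a I, inOKm a -> ideal I -> finite_index I -> ~ (forall x, I x -> FB B (x + a)).
Proof.
move=> prox a I ha iI fI aF; have [b [Bb _]] := Binf nil.
have [ib _ fb] := Bpfi Bb.
have [s [hs sP]] := fi_cap ib iI fb fI.
(* With negated representatives as window, every [g] has some [g - r] in both [b] and [I], where
   [etaB B] is 0 and its shift by [a] is 1. *)
have [||g [hg _ /= gF]] :=
  prox _ _ (orbit_closure_shift inOK0) (orbit_closure_shift ha) [seq - r | r <- s] nil.
- by move=> f /mapP [r /hs hr ->]; apply: inOKN.
- by [].
have [r rs [br Ir]] := sP g hg.
have := gF (- r) (map_f _ rs); rewrite addr0 [- r + g]addrC.
rewrite (etaB_MB (x := g - r)); last by exists b.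
by move=> /esym/negP; apply; apply/pbP; apply: aF.
Qed.

(** For an ideal [J] inside all of [Is], the coset [J + 1] meets none of them, as proper ideals omit
    1; by hypothesis it meets [MB B]. *)
Lemma cosets_avoid_ideals :
  (forall a I, inOKm a -> ideal I -> finite_index I -> ~ (forall x, I x -> FB B (x + a))) ->
  forall Is : list iset, (forall I, List.In I Is -> pfi_ideal I) ->
  exists x, MB B x /\ forall I, List.In I Is -> ~ I x.
Proof.
move=> hE Is hIs; apply: NNPP => no.
have [|J [iJ fJ hJ]] := @ideal_caps Is; first by move=> I /hIs [].
apply: (hE vone J inOK1 iJ fJ) => x Jx.
have hx : inOKm x by case: iJ => h _ _ _; apply: h.
split; first by apply: inOKD => //; apply: inOK1.
move=> Mx; apply: no; exists (x + vone); split=> // I IIs Ix1.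
have [iI pI _] := hIs I IIs; apply: (proper1 iI pI).
by have := idealB iI Ix1 (hJ I IIs x Jx); rewrite addrC addKr.
Qed.

(** Greedy choice. If no [b] is coprime to all of [s], each [b] lies in a proper sum [b + c] with
    [c] in [s], hence in one of finitely many proper ideals, which then cover [MB B]. *)
Lemma avoid_ideals_coprime_sequence :
  (forall Is : list iset, Is <> nil -> (forall I, List.In I Is -> pfi_ideal I) ->
     exists x, MB B x /\ forall I, List.In I Is -> ~ I x) ->
  exists u, coprime_sequence u.
Proof.
move=> hC.
have [s hs|u [Bu cu]] := @greedy_sequence _ B (@coprime_ideals K m); last first.
  exists u; split=> // i j /eqP; rewrite neq_ltn => /orP [ij|ij]; last exact: cu.
  by apply: coprime_sym; apply: cu.
case: s hs => [_|c0 s hs]; first by have [b [Bb _]] := Binf nil; exists b; split.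
apply: NNPP => no.
have [|L [L1 L2]] := @ideals_above_list (c0 :: s).
  by move=> c /hs /Bpfi [].
have pc0 := Bpfi (hs c0 (or_introl erefl)).
(* [hC] speaks of nonempty lists only; [c0] is itself a proper ideal above [c0]. *)
have Ln : L <> nil.
  by have [I IL _] := L2 c0 c0 (or_introl erefl) pc0 (fun _ => id) => LE; rewrite LE in IL.
have [x [[b [Bb bx]] nL]] := hC L Ln L1.
apply: no; exists b; split=> // c cs; apply: NNPP => nc.
have [ib _ fb] := Bpfi Bb; have [ic _ _] := Bpfi (hs c cs).
have [|I IL hI] := L2 c (ideal_sum b c) cs (ideal_sum_pfi ib ic fb nc).
  by move=> y cy; exists 0, y; rewrite add0r; case: ib.
apply: (nL I IL); apply: hI; exists x, 0; rewrite addr0; split=> //.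
by split=> //; case: ic.
Qed.

(** Coprime proper ideals differ, so each member of a finite list equals at most one [u i], and all
    large indices avoid the list. *)
Lemma coprime_sequence_family u : coprime_sequence u ->
  exists C : iset -> Prop, [/\ forall b, C b -> B b, infinite_family C
    & forall b c, C b -> C c -> ~ same_set b c -> coprime_ideals b c].
Proof.
move=> [Bu cu]; exists (fun b => exists i, b = u i); split.
- by move=> _ [i ->].
- have nsame i j : i <> j -> ~ same_set (u i) (u j).
    by move=> /cu; apply: coprime_not_same; case: (Bpfi (Bu i)).
  move=> s; have [N hN] : exists N, forall i, (N <= i)%N ->
      forall c, List.In c s -> ~ same_set (u i) c.
    elim: s => [|c s [N hN]]; first by exists 0%N.
    case: (excluded_middle_informative (exists i, same_set (u i) c)) => [[i ic]|no]; last first.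
      exists N => i /hN h c' [<-|/h //] si; apply: no; by exists i.
    exists (maxn N i.+1) => j; rewrite geq_max => /andP [/hN h ij] c' [<-|/h //] jc.
    apply: (nsame j i) => [E|x]; first by rewrite E ltnn in ij.
    by split=> [/jc/ic|/ic/jc].
  by exists (u N); split; [exists N|apply: hN].
- move=> _ _ [i ->] [j ->] ns; apply: cu => E; apply: ns; rewrite E => x; tauto.
Qed.

(** Infinitude of [C] is the extension step of a greedy choice of pairwise distinct sets. *)
Lemma family_coprime_sequence (C : iset -> Prop) :
  (forall b, C b -> B b) -> infinite_family C ->
  (forall b c, C b -> C c -> ~ same_set b c -> coprime_ideals b c) ->
  exists u, coprime_sequence u.
Proof.
move=> CB Cinf Cco.
have [s _|u [Cu nu]] := @greedy_sequence _ C (fun b c => ~ same_set b c).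
  exact: Cinf.
exists u; split=> [i|i j /eqP]; first exact: CB.
rewrite neq_ltn => /orP [ij|ij]; last by apply: Cco => //; apply: nu.
by apply: coprime_sym; apply: Cco => //; apply: nu.
Qed.

(* The ideals [u i], [i < size F], are used to cover the window of [x], and the next
   [size F] ideals to cover the window of [y]. *)
Lemma coprime_sequence_zeros u (x y : V -> bool) F : coprime_sequence u ->
  in_orbit_closure (etaB B) x -> in_orbit_closure (etaB B) y -> finite_subset F ->
  exists g, inOKm g /\ forall f, f \in F -> x (f + g) = false /\ y (f + g) = false.
Proof.
move=> [Bu cu] hx hy hF; pose k := size F.
have iu i : ideal (u i) by case: (Bpfi (Bu i)).
have [|J [iJ [rs [hrs rsP]] Ju]] := @ideal_caps (List.map u (List.seq 0 (k + k))).
  by move=> I /List.in_map_iff [i [<- _]]; case: (Bpfi (Bu i)).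
(* The shifts [s] and [s'] depend on the window, and the [g] sought depends on them. Enlarging [F]
   beforehand by all representatives modulo [J] breaks the circle, as [g] is taken among these. *)
pose W := [seq f + r | f <- F, r <- rs].
have hW : finite_subset W.
  by move=> _ /allpairsP [[f r] /= [/hF hf /hrs hr ->]]; apply: inOKD.
have [s [hs sP]] := hx W hW; have [s' [hs' sP']] := hy W hW.
(* [x] at [f + g] is [etaB B] at [f + g + s]; the residue [t i] puts this point in [u i] when [f] is
   entry [i] of [F]. The indices from [k] on do the same for [y]. *)
pose t i := if (i < k)%N then - F`_i - s else - F`_(i - k) - s'.
have hFi i : inOKm F`_i.
  by case: (ltnP i k) => ik; [apply: hF; apply: mem_nth|rewrite nth_default //; apply: inOK0].
have ht i : inOKm (t i) by rewrite /t; case: ifP => _; apply: inOKB => //; apply: inOKN.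
have [h [hh hP]] := @crt u iu cu t (k + k)%N ht.
(* Reduction modulo [J] keeps the congruences, as [J] lies in each [u i] used. *)
have [g grs Jg] := rsP h hh.
have ug i : (i < k + k)%N -> u i (g - t i).
  move=> ik; apply: ideal_trans (hP i ik) => //; apply: idealBC => //.
  apply: (Ju _ _ _ Jg); apply: List.in_map; apply/List.in_seq; lia.
have hg : inOKm g by apply: hrs.
exists g; split=> // f fF.
have fW : f + g \in W by apply/allpairsP; exists (f, g).
rewrite -(sP _ fW) -(sP' _ fW).
have ik : (index f F < k)%N by rewrite index_mem.
split; apply: etaB_MB.
  exists (u (index f F)); split=> //; have := ug (index f F) (ltn_addr _ ik).
  by rewrite /t ik nth_index // opprD !opprK addrA [g + f]addrC.
exists (u (k + index f F)%N); split=> //.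
have := ug (k + index f F)%N; rewrite ltn_add2l ik => /(_ isT).
by rewrite /t ltnNge leq_addr /= addKn nth_index // opprD !opprK addrA [g + f]addrC.
Qed.

(** [K] extends the rationals, so it has characteristic zero, and [0 < m] gives a coordinate to
    read. *)
Lemma vone_mulrn_inj : (0 < m)%N -> injective (fun n => vone *+ n).
Proof.
move=> m0 i j /rowP /(_ (Ordinal m0)); rewrite !mulmxnE !mxE.
rewrite -(rmorph_nat (in_alg K) i) -(rmorph_nat (in_alg K) j) => /fmorph_inj /eqP.
by rewrite eqr_nat => /eqP.
Qed.

Lemma coprime_sequence_proximal u : (0 < m)%N -> coprime_sequence u ->
  proximal_system (etaB B).
Proof.
move=> m0 hu x y hx hy F E hF _.
have hl l : inOKm (vone *+ l).
  by elim: l => [|l IH]; [apply: inOK0|rewrite mulrS; apply: inOKD IH; apply: inOK1].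
(* Common zeros are sought on the translates of [F] by [size E + 1] multiples of [vone]: the
   resulting shifts are distinct, so one is outside [E]. *)
have [|g [hg gP]] := @coprime_sequence_zeros u x y
    [seq f + vone *+ l | f <- F, l <- iota 0 (size E).+1] hu hx hy.
  by move=> _ /allpairsP [[f l] /= [/hF hf _ ->]]; apply: inOKD.
have [l ll lE] : exists2 l, l \in iota 0 (size E).+1 & vone *+ l + g \notin E.
  apply/hasP; apply: contraT => /hasPn sub.
  have : (size [seq (vone *+ l + g)%R | l <- iota 0 (size E).+1] <= size E)%N.
    apply: uniq_leq_size => [|z /mapP [l hl' ->]].
      by rewrite map_inj_uniq ?iota_uniq // => i j /addIr /(vone_mulrn_inj m0).
    by have := sub l hl'; rewrite negbK.
  by rewrite size_map size_iota ltnn.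
exists (vone *+ l + g); split=> // [|f fF]; first exact: inOKD.
have := gP (f + vone *+ l); rewrite addrA.
case=> [|-> ->] //; by apply/allpairsP; exists (f, l).
Qed.

(** * Thickness of the set of multiples *)

Definition thick (A : iset) : Prop := forall F : seq V, finite_subset F ->
  exists h, inOKm h /\ forall f, f \in F -> A (f + h).

Lemma thick_MB : thick (MB B) <-> in_orbit_closure (etaB B) (fun _ => false).
Proof.
split=> hB F hF; have [h [hh fP]] := hB F hF; exists h; split=> // f fF.
  by apply: etaB_MB; apply: fP.
by apply: etaB_false; [apply: inOKD => //; apply: hF|apply: fP].
Qed.

Lemma coprime_sequence_thick u : coprime_sequence u -> thick (MB B).
Proof.
move=> hu F hF; have h0 := orbit_closure_shift inOK0.
have [g [hg gP]] := coprime_sequence_zeros hu h0 h0 hF.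
exists g; split=> // f fF; apply: etaB_false; first by apply: inOKD => //; apply: hF.
by have [] := gP f fF; rewrite addr0.
Qed.

(** Let [h] translate all [a - r] into [MB B]: for the representative [r] of [h], the point
    [a - r + h] also lies in [I + a]. *)
Lemma thick_meets_cosets : thick (MB B) ->
  forall a I, inOKm a -> ideal I -> finite_index I -> ~ (forall x, I x -> FB B (x + a)).
Proof.
move=> tB a I ha iI [s [hs sP]] aF.
have [|h [hh hP]] := tB [seq a - r | r <- s].
  by move=> _ /mapP [r /hs hr ->]; apply: inOKB.
have [r rs Ir] := sP h hh.
have [_] := aF _ Ir; apply; have := hP _ (map_f (fun r => a - r) rs).
by rewrite addrC addrCA [h - r + a]addrC.
Qed.

End Conditions.

(** * Density *)

(** [K] is finite-dimensional over the rationals, so a vector is coded by its finitely many rational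
    coordinates. *)
Lemma countable_V : exists e : nat -> V, forall x, exists n, e n = x.
Proof.
pose b := vbasis {:K}.
pose dec (s : seq 'rV[rat]_(\dim {:K})) : V := \row_i \sum_j (nth 0 s i) 0 j *: b`_j.
exists (fun n => if unpickle n is Some s then dec s else 0) => x.
exists (pickle [seq \row_j coord b j (x 0 i) | i <- enum 'I_m]); rewrite pickleK.
apply/rowP => i; rewrite mxE (nth_map i) ?size_enum_ord // nth_ord_enum.
rewrite [RHS](coord_vbasis (memvf (x 0 i))).
by apply: eq_bigr => j _; rewrite mxE.
Qed.

(** Take a box invariant up to [1 / (n + 1)] under those of the first [n + 1] vectors of an
    enumeration that satisfy [inOKm]; each fixed [g] is among them from some index on. *)
Lemma folner_exists : exists F : nat -> seq V, folner F.
Proof.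
have [e eP] := countable_V.
pose s n := [seq x <- [seq e i | i <- iota 0 n.+1] | pb (inOKm x)].
have inv_pos n : 0 < (n.+1%:R : rat)^-1 by rewrite invr_gt0.
have ex n := almost_invariant (s n) (inv_pos n).
pose L n := proj1_sig (constructive_indefinite_description _ (ex n)).
have LP n := proj2_sig (constructive_indefinite_description _ (ex n)).
exists (fun n => box (L n).+1 (s n)); split=> [n|g hg d d0].
  split; first exact: box_uniq.
  split; last by have := box0 (L n) (s n); case: (box _ _).
  move=> x; apply: box_closed; [exact: inOK0|exact: inOKD|].
  by move=> h; rewrite mem_filter => /andP [/pbP].
have [j ej] := eP g.
have db : 0 <= d^-1 by rewrite invr_ge0 ltW.
exists (maxn j (Num.Def.archi_bound d^-1)) => n; rewrite geq_max => /andP [jn dn].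
have gs : g \in s n.
  by rewrite mem_filter -ej map_f ?mem_iota // andbT; apply/pbP; rewrite ej.
apply: lt_trans (LP n g gs) _.
rewrite -[d]invrK ltf_pV2 ?posrE ?invr_gt0 //.
by apply: lt_le_trans (archi_boundP db) _; rewrite ler_nat leqW.
Qed.

(** By commutativity, translating [F n] also translates its overlap with [F n + g]. *)
Lemma folner_translate (F : nat -> seq V) (h : nat -> V) : folner F ->
  (forall n, inOKm (h n)) -> folner (fun n => [seq x + h n | x <- F n]).
Proof.
move=> [F1 F2] hh; split=> [n|g hg e e0].
  have [uF [iF nF]] := F1 n; split; first by rewrite map_inj_uniq //; apply: addIr.
  split; first by move=> _ /mapP [x /iF hx ->]; apply: inOKD.
  by case: (F n) nF.
have [N hN] := F2 g hg e e0; exists N => n /hN.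
suff -> : Defs.ratio (fun x => x - g \in [seq y + h n | y <- F n]) [seq x + h n | x <- F n]
  = Defs.ratio (fun x => x - g \in F n) (F n) by [].
rewrite /Defs.ratio count_map size_map; congr (_%:R / _); apply: eq_count => x /=.
by rewrite addrAC; exact: (mem_map (@addIr _ (h n))) (x - g).
Qed.

Lemma ratio_le1 (p : V -> bool) F : Defs.ratio p F <= 1.
Proof.
rewrite /Defs.ratio; case: (posnP (size F)) => [->|F0]; first by rewrite invr0 mulr0.
by rewrite ler_pdivrMr ?ltr0n // mul1r ler_nat count_size.
Qed.

Lemma thick_density_one (A : iset) : thick A -> upper_banach_density_one A.
Proof.
move=> tA; split=> [F _ e e0|e e0].
  by exists 0%N => n _; apply: le_lt_trans (ratio_le1 _ _) _; rewrite ltrDl.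
have [F fF] := folner_exists.
have ex n : exists h, inOKm h /\ forall f, f \in F n -> A (f + h).
  by apply: tA; case: fF => /(_ n) [_ []].
pose h n := proj1_sig (constructive_indefinite_description _ (ex n)).
have hP n : inOKm (h n) /\ forall f, f \in F n -> A (f + h n).
  by rewrite /h; case: constructive_indefinite_description.
exists (fun n => [seq x + h n | x <- F n]); split.
  by apply: folner_translate => // n; case: (hP n).
move=> d d0 N; exists N; split=> //; rewrite /Defs.ratio.
have nF : F N <> [::] by case: fF => /(_ N) [_ []].
have /eqP -> : count (fun x => pb (A x)) [seq x + h N | x <- F N]
    == size [seq x + h N | x <- F N].
  by rewrite -all_count; apply/allP => _ /mapP [x xF ->]; apply/pbP; case: (hP N) => _; apply.
rewrite divff; last by rewrite pnatr_eq0 size_map; case: (F N) nF.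
by lra.
Qed.

(** Inclusion-exclusion: subtracting [g] sends the points counted twice injectively to points of [F]
    satisfying [p]. *)
Lemma count_translate (F : seq V) (p : V -> bool) g : uniq F ->
  (count (fun x => p (x - g)%R) F + count (fun x => (x - g)%R \in F) F
     <= count p F + size F)%N.
Proof.
move=> uF; rewrite -count_predUI addnC leq_add ?count_size //.
rewrite -!size_filter -(size_map (+%R^~ (- g))); apply: uniq_leq_size.
  by rewrite map_inj_uniq ?filter_uniq //; apply: addIr.
move=> y /mapP [x]; rewrite mem_filter => /andP [/andP [/= h1 h2] _] ->.
by rewrite mem_filter h1.
Qed.

(** Finitely many cosets of [I] cover [F n], and by near invariance the density of each exceeds that
    of [I + a] by at most [c]. *)
Lemma coset_density a I : inOKm a -> ideal I -> finite_index I ->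
  exists2 c : rat, 0 < c & forall F : nat -> seq V, folner F ->
    exists N, forall n, (N <= n)%N -> c <= Defs.ratio (fun x => pb (I (x - a))) (F n).
Proof.
move=> ha iI [s [hs sP]].
(* The successor makes [q] positive whatever [s] is; with [c = 1 / (2 q)], the bound
   [1 <= q (rho + c)] gives [rho >= c]. *)
pose q : rat := (size s).+1%:R; have q0 : 0 < q by rewrite ltr0n.
pose c := (2 * q)^-1; have c0 : 0 < c by rewrite invr_gt0 mulr_gt0.
exists c => // F [F1 F2].
have [N hN] : exists N, forall n, (N <= n)%N -> forall r, r \in s ->
    `|1 - Defs.ratio (fun x => x - (r - a) \in F n) (F n)| < c.
  have : forall r, r \in s -> inOKm (r - a) by move=> r /hs hr; apply: inOKB.
  elim: (s) => [|r t IH] ht; first by exists 0%N.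
  have [|N hN] := IH; first by move=> r' h; apply: ht; rewrite inE h orbT.
  have [|M hM] := F2 (r - a) _ c c0; first by apply: ht; rewrite inE eqxx.
  exists (maxn N M) => n; rewrite geq_max => /andP [Nn Mn] r'.
  by rewrite inE => /orP [/eqP ->|]; [apply: hM|apply: hN].
exists N => n Nn; have [uF [iF nF]] := F1 n.
set rho := Defs.ratio _ _.
have S0 : (0 : rat) < (size (F n))%:R by rewrite ltr0n; case: (F n) nF.
have step r : r \in s -> Defs.ratio (fun x => pb (I (x - r))) (F n) <= rho + c.
  move=> rs; have := count_translate (fun x => pb (I (x - a))) (r - a) uF.
  rewrite -(ler_nat rat) !natrD -(ler_pM2r (x := (size (F n))%:R^-1)) ?invr_gt0 //.
  rewrite !mulrDl divff ?gt_eqF //.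
  have -> : count (fun x => pb (I (x - (r - a) - a))) (F n)
          = count (fun x => pb (I (x - r))) (F n).
    by apply: eq_count => x; rewrite opprB addrA addrAC addrK.
  by have := hN n Nn r rs; rewrite ltr_norml /rho /Defs.ratio => /andP [_]; lra.
have cover t : (forall r, r \in t -> r \in s) ->
    Defs.ratio (fun x => has (fun r => pb (I (x - r))) t) (F n) <= (size t)%:R * (rho + c).
  elim: t => [_|r t IH ht].
    by rewrite /Defs.ratio /= (eq_count (a2 := pred0)) // count_pred0 !mul0r.
  have h1 := step r (ht r (mem_head _ _)).
  have h2 : Defs.ratio (fun x => has (fun r => pb (I (x - r))) t) (F n) <= (size t)%:R * (rho + c).
    by apply: IH => r' hr'; apply: ht; rewrite inE hr' orbT.
  rewrite /= -[(size t).+1]addn1 natrD mulrDl mul1r addrC.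
  apply: le_trans (lerD h1 h2).
  rewrite /Defs.ratio -mulrDl ler_pM2r ?invr_gt0 // -natrD ler_nat.
  rewrite -count_predUI leq_addr //.
have := cover s (fun _ => id).
have -> : Defs.ratio (fun x => has (fun r => pb (I (x - r))) s) (F n) = 1.
  rewrite /Defs.ratio; have /eqP -> : count (fun x => has (fun r => pb (I (x - r))) s) (F n)
      == size (F n).
    rewrite -all_count; apply/allP => x xF; apply/hasP.
    by have [r rs Ir] := sP x (iF x xF); exists r => //; apply/pbP.
  by rewrite divff // gt_eqF.
have rho0 : 0 <= rho by rewrite /rho /Defs.ratio divr_ge0.
have cq : q * c * 2 = 1 by rewrite /c mulrAC [q * 2]mulrC divff // gt_eqF // mulr_gt0.
move=> h; have {}h : 1 <= q * (rho + c).
  by apply: le_trans h _; rewrite ler_wpM2r ?ler_nat // addr_ge0 // ltW.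
by rewrite -(ler_pM2l q0); lra.
Qed.

Lemma density_one_meets_cosets B : upper_banach_density_one (MB B) ->
  forall a I, inOKm a -> ideal I -> finite_index I -> ~ (forall x, I x -> FB B (x + a)).
Proof.
move=> [_ dB] a I ha iI fI aF.
have [c c0 cP] := coset_density ha iI fI.
(* A quarter of [c] is lost to the supremum and another to the limsup, less in all than the density
   [c] of the coset missing [MB B]. *)
have c4 : 0 < c / 4 by rewrite divr_gt0.
have [F [fF FB1]] := dB _ c4; have [N hN] := cP F fF.
have [n [Nn]] := FB1 _ c4 N.
have : Defs.ratio (fun x => pb (MB B x)) (F n) + Defs.ratio (fun x => pb (I (x - a))) (F n) <= 1.
  apply: le_trans (ratio_le1 (fun x => pb (MB B x) || pb (I (x - a))) (F n)).
  rewrite /Defs.ratio -mulrDl -natrD -count_predUI [X in (_ + X)%N](_ : _ = 0%N) ?addn0 //.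
  apply/eqP; rewrite -leqn0 leqNgt -has_count; apply/hasPn => x _.
  apply/negP => /andP [/pbP Mx /pbP Ix].
  by have [_] := aF _ Ix; rewrite subrK.
by have := hN n Nn; lra.
Qed.

End Family.

(** * Equivalence of the six conditions *)

Theorem theorem1p2 (K : fieldExtType rat) (m : nat) (hm : (0 < m)%N)
  (B : ('rV[K]_m -> Prop) -> Prop)
  (hBinf : infinite_family B)
  (hBideal : forall b, B b -> pfi_ideal b) :
  let condA := proximal_system (etaB B) in
  let condB := in_orbit_closure (etaB B) (fun _ => false) in
  let condC := forall Is : list ('rV[K]_m -> Prop), Is <> nil ->
      (forall I, List.In I Is -> pfi_ideal I) ->
      exists x, MB B x /\ forall I, List.In I Is -> ~ I x in
  let condD := exists C : ('rV[K]_m -> Prop) -> Prop,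
      [/\ forall b, C b -> B b, infinite_family C
        & forall b c, C b -> C c -> ~ same_set b c -> coprime_ideals b c] in
  let condE := forall a I, inOKm a -> ideal I -> finite_index I ->
      ~ (forall x, I x -> FB B (x + a)) in
  let condF := upper_banach_density_one (MB B) in
  [/\ condA <-> condB, condA <-> condC, condA <-> condD, condA <-> condE
    & condA <-> condF].
Proof.
move=> condA condB condC condD condE condF.
(* With U for the existence of a coprime sequence, A, E, C, U, A is a cycle of implications, D is
   equivalent to U, U gives B, B gives E and F, and F gives E. *)
have AE : condA -> condE by exact: proximal_meets_cosets.
have EC : condE -> condC by move=> hE Is _; apply: cosets_avoid_ideals.
have CU : condC -> exists u, coprime_sequence B u.
  exact: avoid_ideals_coprime_sequence.
have UA u : coprime_sequence B u -> condA by exact: coprime_sequence_proximal.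
have UD u : coprime_sequence B u -> condD by exact: coprime_sequence_family.
have DU : condD -> exists u, coprime_sequence B u.
  by move=> [C [CB Cinf Cco]]; exact: family_coprime_sequence CB Cinf Cco.
have UB u : coprime_sequence B u -> condB.
  by move=> hu; apply/thick_MB; exact: coprime_sequence_thick hu.
have BE : condB -> condE by move=> /thick_MB; exact: thick_meets_cosets.
have BF : condB -> condF by move=> /thick_MB; exact: thick_density_one.
have FE : condF -> condE by exact: density_one_meets_cosets.
have AU : condA -> exists u, coprime_sequence B u by move=> /AE/EC/CU.
have EA : condE -> condA by move=> /EC/CU [u]; exact: UA.
split; split.
- by move=> /AU [u]; exact: UB.
- by move=> /BE/EA.
- by move=> /AE/EC.
- by move=> /CU [u]; exact: UA.
- by move=> /AU [u]; exact: UD.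
- by move=> /DU [u]; exact: UA.
- exact: AE.
- exact: EA.
- by move=> /AU [u] /UB /BF.
- by move=> /FE/EA.
Qed.
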